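(* Let $q\in K^*$ and $z=a_{11}a_{22}^{-1}\in UT_q(2)$. The following is a subgroup of $\mathrm{Aut}(UT_q(2))$: $$\mathcal G=\{\varphi\in\mathrm{End}(UT_q(2)):\ \varphi(a_{12})=\lambda_{12}a_{11}^ka_{22}^la_{12},\ \varphi(a_{ii})=\lambda_{ii}z^ja_{ii}\ (i\in\{1,2\}),\ \text{for some }\lambda_{11},\lambda_{12},\lambda_{22}\in K^*,\ j,k,l\in\mathbb Z\}.$$ Moreover, if $q$ is not a root of unity, then $$\mathrm{Aut}(UT_q(2))=\mathcal G\rtimes\langle\rho\rangle,$$ where $\rho$ is the automorphism of $UT_q(2)$ with $\rho(a_{12})=a_{12}$, $\rho(a_{11})=a_{22}$, $\rho(a_{22})=a_{11}$.
   Context: $K$ is a field of characteristic different from $2$. $T_q(2)$ is the unital associative $K$-algebra generated by $a_{11},a_{12},a_{22}$ with relations $a_{22}a_{12}=qa_{12}a_{22}$, $a_{11}a_{12}=qa_{12}a_{11}$, $a_{11}a_{22}=a_{22}a_{11}$. $UT_q(2)$ is the localization of $T_q(2)$ at the multiplicative set generated by $a_{11}$ and $a_{22}$. $\mathrm{End}(A)$ and $\mathrm{Aut}(A)$ are the monoid of $K$-algebra endomorphisms and the group of $K$-algebra automorphisms of $A$. The semidirect product is internal: $\mathcal G$ is normal, $\mathcal G\cap\langle\rho\rangle$ is trivial, and $\mathcal G\langle\rho\rangle$ is the whole group. *)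

(* Defs.v *)
From HB Require Import structures.
From mathcomp Require Import all_boot all_order all_algebra.
From mathcomp Require Import boolp classical_sets.

Set Implicit Arguments.
Unset Strict Implicit.
Unset Printing Implicit Defensive.

Import GRing.Theory.
Local Open Scope classical_set_scope.
Local Open Scope ring_scope.

Record alg_aut (K : fieldType) (A : algType K) := AlgAut {
  aut_val :> {lrmorphism A -> A};
  aut_bij : bijective aut_val }.

Section AutGroup.
Variables (K : fieldType) (A : algType K).
Local Notation aut := (alg_aut A).

HB.instance Definition _ := gen_eqMixin aut.
HB.instance Definition _ := gen_choiceMixin aut.

Lemma alg_autP (f g : aut) : f =1 g -> f = g.
Proof.
case: f g => [[f [[fN] [fM] [fZ]]] fb] [[g [[gN] [gM] [gZ]]] gb] /= /funext fg.
case: _ / fg in gN gM gZ gb *.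
rewrite (Prop_irrelevance gN fN) (Prop_irrelevance gM fM).
by rewrite (Prop_irrelevance gZ fZ); congr AlgAut; apply: Prop_irrelevance.
Qed.

Definition aut_one : aut := @AlgAut K A idfun (inv_bij (fun=> erefl)).

Definition aut_mul (f g : aut) : aut :=
  @AlgAut K A (aut_val f \o aut_val g) (bij_comp (aut_bij f) (aut_bij g)).

Fact aut_inv_subproof (f : aut) : {g : A -> A | cancel f g /\ cancel g f}.
Proof. by apply: cid; case: (aut_bij f) => g fK gK; exists g. Qed.

Definition aut_inv_fun (f : aut) : A -> A := sval (aut_inv_subproof f).

Fact aut_inv_funK (f : aut) : cancel f (aut_inv_fun f).
Proof. exact: (svalP (aut_inv_subproof f)).1. Qed.

Fact aut_inv_funVK (f : aut) : cancel (aut_inv_fun f) f.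
Proof. exact: (svalP (aut_inv_subproof f)).2. Qed.

Fact aut_inv_is_linear (f : aut) : linear (aut_inv_fun f).
Proof. exact: can2_linear (@aut_inv_funK f) (@aut_inv_funVK f). Qed.

Fact aut_inv_is_monoid_morphism (f : aut) : monoid_morphism (aut_inv_fun f).
Proof.
exact: can2_monoid_morphism (@aut_inv_funK f) (@aut_inv_funVK f).
Qed.

HB.instance Definition _ (f : aut) :=
  GRing.isLinear.Build K A A *:%R (aut_inv_fun f) (aut_inv_is_linear f).
HB.instance Definition _ (f : aut) :=
  GRing.isMonoidMorphism.Build A A (aut_inv_fun f)
    (aut_inv_is_monoid_morphism f).

Definition aut_inv (f : aut) : aut :=
  @AlgAut K A (aut_inv_fun f) (Bijective (@aut_inv_funVK f) (@aut_inv_funK f)).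

Fact aut_mulA : associative aut_mul.
Proof. by move=> f g h; apply: alg_autP. Qed.
Fact aut_mul1 : left_id aut_one aut_mul.
Proof. by move=> f; apply: alg_autP. Qed.
Fact aut_mulr1 : right_id aut_one aut_mul.
Proof. by move=> f; apply: alg_autP. Qed.
Fact aut_mulV : left_inverse aut_one aut_inv aut_mul.
Proof. by move=> f; apply: alg_autP => x; apply: aut_inv_funK. Qed.
Fact aut_mulVr : right_inverse aut_one aut_inv aut_mul.
Proof. by move=> f; apply: alg_autP => x; apply: aut_inv_funVK. Qed.

(* The product of Aut(A) is composition: (f * g)%g x = f (g x). *)
HB.instance Definition _ :=
  isGroup.Build aut aut_mulA aut_mul1 aut_mulr1 aut_mulV aut_mulVr.

End AutGroup.

Section Presentation.
Variables (K : fieldType) (q : K).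

Definition Tq2_relations (A : algType K) (x11 x12 x22 : A) : Prop :=
  [/\ x22 * x12 = q *: (x12 * x22),
      x11 * x12 = q *: (x12 * x11) &
      x11 * x22 = x22 * x11].

(* (T; a11, a12, a22) is the algebra presented by these generators and
   relations, i.e. it is initial among algebras with such a triple. *)
Record is_Tq2 (T : algType K) (a11 a12 a22 : T) : Prop := IsTq2 {
  Tq2_rel : Tq2_relations a11 a12 a22;
  Tq2_lift : forall (B : algType K) (b11 b12 b22 : B),
    Tq2_relations b11 b12 b22 ->
    exists f : {lrmorphism T -> B}, [/\ f a11 = b11, f a12 = b12 & f a22 = b22];
  Tq2_unique : forall (B : algType K) (f g : {lrmorphism T -> B}),
    f a11 = g a11 -> f a12 = g a12 -> f a22 = g a22 -> f =1 g }.

End Presentation.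

Inductive mult_gen (K : fieldType) (A : algType K) (X : set A) : set A :=
| mult_gen1 : mult_gen X 1
| mult_gen_gen x of X x : mult_gen X x
| mult_genM x y of mult_gen X x & mult_gen X y : mult_gen X (x * y).

(* iota : T -> U is the localization of T at S, i.e. it is initial among
   morphisms from T that send S to units. *)
Record is_localization (K : fieldType) (T : algType K) (S : set T)
    (U : unitAlgType K) (iota : {lrmorphism T -> U}) : Prop :=
    IsLocalization {
  loc_unit : forall s, S s -> iota s \is a GRing.unit;
  loc_lift : forall (B : unitAlgType K) (f : {lrmorphism T -> B}),
    (forall s, S s -> f s \is a GRing.unit) ->
    exists g : {lrmorphism U -> B}, forall t, g (iota t) = f t;
  loc_unique : forall (B : unitAlgType K) (g h : {lrmorphism U -> B}),
    (forall t, g (iota t) = h (iota t)) -> g =1 h }.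

(* phi satisfies the condition defining the family G; x11, x12, x22 stand for
   the images of the generators in UT_q(2). *)
Definition in_calG (K : fieldType) (U : unitAlgType K) (x11 x12 x22 : U)
    (phi : {lrmorphism U -> U}) : Prop :=
  let z := x11 / x22 in
  exists (l11 l12 l22 : K) (j k l : int),
    [/\ [/\ l11 != 0, l12 != 0 & l22 != 0],
        phi x12 = l12 *: (x11 ^ k * x22 ^ l * x12),
        phi x11 = l11 *: (z ^ j * x11) &
        phi x22 = l22 *: (z ^ j * x22)].

Section InternalSemidirect.
Variable gT : groupType.
Local Open Scope group_scope.

Definition is_subgroup (H : set gT) : Prop := group_closed (mem H).

Definition is_normal (N : set gT) : Prop :=
  is_subgroup N /\ forall x y, N x -> N (x ^ y).

Definition cyclic_sub (x : gT) : set gT :=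
  [set y | exists n : nat, y = x ^+ n \/ y = x ^- n].

Definition is_internal_sdprod (N H : set gT) : Prop :=
  [/\ is_normal N, is_subgroup H, N `&` H = [set 1] &
      forall x, exists2 n, N n & exists2 h, H h & x = n * h].

End InternalSemidirect.

(* Main.v *)
Require Import Defs.
From HB Require Import structures.
From mathcomp Require Import all_boot all_order all_algebra zify ring.
From mathcomp Require Import boolp classical_sets.
Import GRing.Theory.
Local Open Scope classical_set_scope.
Local Open Scope ring_scope.

Set Implicit Arguments.
Unset Strict Implicit.
Unset Printing Implicit Defensive.

(* The monomials x11^a x22^b x12^n (a, b integers, n natural) form a basis of
   UT_q(2), and they multiply up to nonzero scalars by adding exponents.
   Comparing lexicographically largest and smallest terms, a product that is a
   monomial has factors that are scaled monomials; in particular the units are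
   the c x11^a x22^b with c <> 0.  An automorphism phi therefore sends x11 and
   x22 to such units.  If q is not a root of unity, x11 x12 = q x12 x11 and
   x22 x12 = q x12 x22 force phi(x12) to have degree 1 in x12 and phi(x11),
   phi(x22) to have total degree 1.  Hence phi(z) = c z^e with e invertible in
   Z, and phi(x12) is a monomial because it divides x12.  The case e = 1 is G,
   and e = -1 is reduced to it by composing with rho. *)

(* The universal property of a localization only concerns algebras with a chosen
   inversion; by excluded middle and choice every algebra can be given one. *)
Definition with_units (K : fieldType) (A : algType K) : Type := A.

Section WithUnits.
Variables (K : fieldType) (A : algType K).
Local Notation W := (with_units A).

HB.instance Definition _ := GRing.Algebra.on W.

Definition has_inverse (x : W) : bool := `[< exists y, y * x = 1 /\ x * y = 1 >].

Definition chosen_inverse (x : W) : W :=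
  if pselect (exists y, y * x = 1 /\ x * y = 1) is left h then sval (cid h)
  else x.

Let mulVx : {in has_inverse, left_inverse 1 chosen_inverse *%R}.
Proof.
move=> x /asboolP hx; rewrite /chosen_inverse; case: pselect => // h.
exact: (svalP (cid h)).1.
Qed.

Let mulxV : {in has_inverse, right_inverse 1 chosen_inverse *%R}.
Proof.
move=> x /asboolP hx; rewrite /chosen_inverse; case: pselect => // h.
exact: (svalP (cid h)).2.
Qed.

Let has_inverseP (x y : W) : y * x = 1 /\ x * y = 1 -> has_inverse x.
Proof. by move=> xy; apply/asboolP; exists y. Qed.

Let chosen_inverse_out : {in [predC has_inverse], chosen_inverse =1 id}.
Proof.
by move=> x /asboolPn hx; rewrite /chosen_inverse; case: pselect.
Qed.

HB.instance Definition _ :=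
  GRing.NzRing_hasMulInverse.Build W mulVx mulxV has_inverseP chosen_inverse_out.

End WithUnits.

(* [(a, b, n)] stands for the monomial x11^a x22^b x12^n. *)
Definition idx : Type := (int * int * nat)%type.

(* U acts on all functions [idx -> K], finitely supported or not, by shifts of
   the exponents; this gives the linear independence of the monomials. *)
Section LinEnd.
Variable K : fieldType.

Record lin_end := LinEnd {
  lin_end_val :> (idx -> K) -> (idx -> K);
  lin_endL : forall a v w i,
    lin_end_val (fun j => a * v j + w j) i =
    a * lin_end_val v i + lin_end_val w i }.

HB.instance Definition _ := gen_eqMixin lin_end.
HB.instance Definition _ := gen_choiceMixin lin_end.

Lemma lin_endP (f g : lin_end) : (forall v i, f v i = g v i) -> f = g.
Proof.
case: f g => [f fl] [g gl] /= fg; have {}fg: f = g by do 2!apply/funext=> ?.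
by case: _ / fg in gl *; congr LinEnd; apply: Prop_irrelevance.
Qed.

Lemma lin_end0 (f : lin_end) i : f (fun=> 0) i = 0.
Proof.
have := lin_endL f (-1) (fun=> 0) (fun=> 0) i.
by rewrite (_ : (fun j => _) = (fun=> 0)) ?mulN1r ?addNr//; apply/funext => j;
  rewrite mulr0 addr0.
Qed.

Lemma lin_endD (f : lin_end) v w i :
  f (fun j => v j + w j) i = f v i + f w i.
Proof.
have := lin_endL f 1 v w i; rewrite mul1r => <-.
by congr (f _ i); apply/funext => j; rewrite mul1r.
Qed.

Lemma lin_endZ (f : lin_end) a v i : f (fun j => a * v j) i = a * f v i.
Proof.
have := lin_endL f a v (fun=> 0) i; rewrite lin_end0 addr0 => <-.
by congr (f _ i); apply/funext => j; rewrite addr0.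
Qed.

Program Definition lin_end_zero := @LinEnd (fun _ _ => 0) _.
Next Obligation. by rewrite mulr0 addr0. Qed.
Program Definition lin_end_one := @LinEnd id _.
Program Definition lin_end_add (f g : lin_end) :=
  @LinEnd (fun v i => f v i + g v i) _.
Next Obligation. by rewrite !lin_endL mulrDr addrACA. Qed.
Program Definition lin_end_opp (f : lin_end) := @LinEnd (fun v i => - f v i) _.
Next Obligation. by rewrite lin_endL opprD mulrN. Qed.
Program Definition lin_end_mul (f g : lin_end) := @LinEnd (fun v => f (g v)) _.
Next Obligation.
by rewrite -lin_endL; congr (f _ i); apply/funext => j; rewrite lin_endL.
Qed.
Program Definition lin_end_scale c (f : lin_end) :=
  @LinEnd (fun v i => c * f v i) _.
Next Obligation. by rewrite lin_endL mulrDr mulrCA. Qed.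

Let addA : associative lin_end_add.
Proof. by move=> f g h; apply: lin_endP => v i /=; rewrite addrA. Qed.
Let addC : commutative lin_end_add.
Proof. by move=> f g; apply: lin_endP => v i /=; rewrite addrC. Qed.
Let add0 : left_id lin_end_zero lin_end_add.
Proof. by move=> f; apply: lin_endP => v i /=; rewrite add0r. Qed.
Let addN : left_inverse lin_end_zero lin_end_opp lin_end_add.
Proof. by move=> f; apply: lin_endP => v i /=; rewrite addNr. Qed.

HB.instance Definition _ := GRing.isZmodule.Build lin_end addA addC add0 addN.

Let mulA : associative lin_end_mul.
Proof. by move=> f g h; apply: lin_endP. Qed.
Let mul1 : left_id lin_end_one lin_end_mul.
Proof. by move=> f; apply: lin_endP. Qed.
Let mulr1 : right_id lin_end_one lin_end_mul.
Proof. by move=> f; apply: lin_endP. Qed.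
Let mulDl : left_distributive lin_end_mul +%R.
Proof. by move=> f g h; apply: lin_endP. Qed.
Let mulDr : right_distributive lin_end_mul +%R.
Proof. by move=> f g h; apply: lin_endP => v i; apply: lin_endD. Qed.
Let one_neq0 : lin_end_one != 0.
Proof.
apply/eqP => /(congr1 (fun f : lin_end => f (fun=> 1) (0, 0, 0%N))) /= /eqP.
by rewrite oner_eq0.
Qed.

HB.instance Definition _ := GRing.Zmodule_isNzRing.Build lin_end
  mulA mul1 mulr1 mulDl mulDr one_neq0.

Let scaleA a b (f : lin_end) :
  lin_end_scale a (lin_end_scale b f) = lin_end_scale (a * b) f.
Proof. by apply: lin_endP => v i /=; rewrite mulrA. Qed.
Let scale1 : left_id 1 lin_end_scale.
Proof. by move=> f; apply: lin_endP => v i /=; rewrite mul1r. Qed.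
Let scaleDr : right_distributive lin_end_scale +%R.
Proof. by move=> a f g; apply: lin_endP => v i /=; rewrite mulrDr. Qed.
Let scaleDl (f : lin_end) : {morph lin_end_scale^~ f : a b / a + b}.
Proof. by move=> a b; apply: lin_endP => v i /=; rewrite mulrDl. Qed.

HB.instance Definition _ := GRing.Zmodule_isLmodule.Build K lin_end
  scaleA scale1 scaleDr scaleDl.

Let scaleAl (a : K) (f g : lin_end) : a *: (f * g) = (a *: f) * g.
Proof. exact: lin_endP. Qed.
HB.instance Definition _ := GRing.Lmodule_isLalgebra.Build K lin_end scaleAl.
Let scaleAr (a : K) (f g : lin_end) : a *: (f * g) = f * (a *: g).
Proof. by apply: lin_endP => v i /=; rewrite -[LHS]lin_endZ. Qed.
HB.instance Definition _ := GRing.Lalgebra_isAlgebra.Build K lin_end scaleAr.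

End LinEnd.

(** * Subalgebras as algebras, with their inclusion map *)

Section SubAlg.
Variables (K : fieldType) (A : algType K) (P : {pred A}).

(** The closure proof is a parameter of the type, so that the algebra structure can be attached to
    the type itself. *)
Definition sub_alg (_ : GRing.subalg_closed P) : Type := {x : A | x \in P}.

Hypothesis Palg : GRing.subalg_closed P.
Local Notation S := (sub_alg Palg).

HB.instance Definition _ := SubChoice.on S.
HB.instance Definition _ := GRing.SubChoice_isSubAlgebra.Build K A P S
   (GRing.subalg_closed_semi Palg).

Definition sub_alg_val (x : with_units S) : A := \val (x : S).

Arguments sub_alg_val : simpl never.

Let sub_alg_val_linear : linear sub_alg_val.
Proof. by move=> a x y; rewrite /sub_alg_val linearP. Qed.
Let sub_alg_val_monoid : monoid_morphism sub_alg_val.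
Proof. by split=> [|x y]; rewrite /sub_alg_val ?rmorph1 ?rmorphM. Qed.

HB.instance Definition _ := GRing.isLinear.Build K (with_units S) A *:%R
  sub_alg_val sub_alg_val_linear.
HB.instance Definition _ := GRing.isMonoidMorphism.Build (with_units S) A
  sub_alg_val sub_alg_val_monoid.

Lemma sub_alg_val_inj : injective sub_alg_val.
Proof. exact: val_inj. Qed.

Lemma sub_alg_valP x : sub_alg_val x \in P.
Proof. exact: (valP (x : S)). Qed.

Lemma sub_alg_val_surj x : x \in P -> exists s, sub_alg_val s = x.
Proof. by move=> xP; exists (Sub x xP : S); apply: SubK. Qed.

End SubAlg.
Arguments sub_alg_val : simpl never.

(** * The universal property of UT_q(2) *)

Section Presented.
Variables (K : fieldType) (q : K).

(** Presentation and localization merged into one universal property: [U] is initial among algebras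
    with a triple satisfying the relations whose outer members are invertible. The rest of the proof
    uses only this property. *)
Record is_UTq2 (U : unitAlgType K) (x11 x12 x22 : U) : Prop := IsUTq2 {
  UTq2_rel : Tq2_relations q x11 x12 x22;
  UTq2_unit11 : x11 \is a GRing.unit;
  UTq2_unit22 : x22 \is a GRing.unit;
  UTq2_lift : forall (B : unitAlgType K) (b11 b12 b22 : B),
    Tq2_relations q b11 b12 b22 ->
    b11 \is a GRing.unit -> b22 \is a GRing.unit ->
    exists f : {lrmorphism U -> B}, [/\ f x11 = b11, f x12 = b12 & f x22 = b22];
  UTq2_unique : forall (B : unitAlgType K) (f g : {lrmorphism U -> B}),
    f x11 = g x11 -> f x12 = g x12 -> f x22 = g x22 -> f =1 g }.

Lemma Tq2_relations_morph (A B : algType K) (f : {lrmorphism A -> B}) x y z :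
  Tq2_relations q x y z -> Tq2_relations q (f x) (f y) (f z).
Proof. by case=> h1 h2 h3; split; rewrite -!rmorphM /= ?h1 ?h2 ?h3 ?linearZ. Qed.

Lemma localization_UTq2 (T : algType K) (a11 a12 a22 : T) (U : unitAlgType K)
    (iota : {lrmorphism T -> U}) :
  is_Tq2 q a11 a12 a22 -> is_localization (mult_gen [set a11; a22]) iota ->
  is_UTq2 (iota a11) (iota a12) (iota a22).
Proof.
move=> hT hU; split.
- exact: Tq2_relations_morph (Tq2_rel hT).
- by apply: (loc_unit hU); apply: mult_gen_gen; left.
- by apply: (loc_unit hU); apply: mult_gen_gen; right.
- move=> B b11 b12 b22 bR u11 u22.
  have [f [f11 f12 f22]] := Tq2_lift hT bR.
  (* Units are closed under products, so inverting the images of the two generators inverts the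
     whole multiplicative set. *)
  have [|g gf] := loc_lift hU (f := f).
    move=> s; elim=> [|x [->|->]|x y _ ux _ uy]; rewrite ?f11 ?f22//.
      by rewrite rmorph1 unitr1.
    by rewrite rmorphM unitrMl.
  by exists g; rewrite !gf.
- move=> B f g e11 e12 e22; apply: (loc_unique hU).
  exact: (Tq2_unique hT (f := f \o iota) (g := g \o iota)).
Qed.

Section Induction.
Variables (U : unitAlgType K) (x11 x12 x22 : U).
Hypothesis hU : is_UTq2 x11 x12 x22.

(* The inclusion of [P] has a section given by the universal property of [U]. *)
Lemma UTq2_ind (P : {pred U}) : GRing.subalg_closed P ->
  x11 \in P -> x11^-1 \in P -> x12 \in P -> x22 \in P -> x22^-1 \in P ->
  forall u, u \in P.
Proof.
move=> Palg P11 PV11 P12 P22 PV22 u.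
have surj := sub_alg_val_surj Palg.
have [[s11 e11] [s12 e12]] := (surj _ P11, surj _ P12).
have [[s22 e22] [t11 eV11]] := (surj _ P22, surj _ PV11).
have [t22 eV22] := surj _ PV22.
have val_inj := @sub_alg_val_inj K U P Palg.
have [r1 r2 r3] := UTq2_rel hU.
have [||| f [f11 f12 f22]] := @UTq2_lift _ _ _ _ hU _ s11 s12 s22.
- by split; apply: val_inj; rewrite ?linearZ !rmorphM/= ?e12 ?e11 ?e22.
(* The lift needs units inside the subalgebra; this is where [x11^-1] and [x22^-1] belonging to [P]
   comes in. *)
- apply/unitrP; exists t11; split; apply: val_inj;
    rewrite rmorphM rmorph1/= e11 eV11.
    exact: mulVr (UTq2_unit11 hU).
  exact: mulrV (UTq2_unit11 hU).
- apply/unitrP; exists t22; split; apply: val_inj;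
    rewrite rmorphM rmorph1/= e22 eV22.
    exact: mulVr (UTq2_unit22 hU).
  exact: mulrV (UTq2_unit22 hU).
pose g : {lrmorphism U -> U} := @sub_alg_val K U P Palg \o f.
have -> : u = g u.
  by apply: (UTq2_unique hU (f := idfun) (g := g)); rewrite /= ?f11 ?f12 ?f22.
exact: sub_alg_valP.
Qed.
End Induction.
End Presented.

(** * The monomial basis *)

Definition addi (i j : idx) : idx :=
  (i.1.1 + j.1.1, i.1.2 + j.1.2, (i.2 + j.2)%N).

Definition lexi (i j : idx) : bool :=
  (i.1.1 < j.1.1)%R || (i.1.1 == j.1.1) &&
    ((i.1.2 < j.1.2)%R || (i.1.2 == j.1.2) && (i.2 <= j.2)%N).

Lemma lexi_total : total lexi.
Proof. by case=> [[a b] n] [[c d] m]; rewrite /lexi /=; lia. Qed.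

Lemma lexi_trans : transitive lexi.
Proof. by case=> [[a b] n] [[c d] m] [[e f] p]; rewrite /lexi /=; lia. Qed.

Lemma lexi_anti : antisymmetric lexi.
Proof.
case=> [[a b] n] [[c d] m]; rewrite /lexi /= => h.
by congr (_, _, _); lia.
Qed.

(** The order is total and strictly compatible with addition, so a strict inequality in either
    argument would make the sums differ. *)
Lemma lexi_addi_cancel i j i0 j0 :
  lexi i i0 -> lexi j j0 -> addi i j = addi i0 j0 -> i = i0 /\ j = j0.
Proof.
move: i j i0 j0 => [[a b] n] [[c d] m] [[a0 b0] n0] [[c0 d0] m0].
rewrite /lexi /addi /= => h1 h2 [e1 e2 e3].
by split; congr (_, _, _); lia.
Qed.

Lemma seq_maximum (T : eqType) (le : rel T) (s : seq T) : total le ->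
  transitive le -> s != [::] -> exists2 x, x \in s & forall y, y \in s -> le y x.
Proof.
move=> le_total le_trans; elim: s => //= x [|y s] IHs _.
  exists x => [|z]; rewrite inE// => /eqP ->.
  by have := le_total x x; rewrite orbb.
have [//|z zs zmax] := IHs; have := le_total x z; case/orP=> lexz.
  exists z => [|t]; first by rewrite inE zs orbT.
  by rewrite inE => /orP[/eqP->|/zmax].
exists x => [|t]; first by rewrite inE eqxx.
rewrite inE => /orP[/eqP->|/zmax/le_trans]; last exact.
by have := le_total x x; rewrite orbb.
Qed.

(** * Commutation up to a scalar *)

Section SkewCommutation.
Variables (K : fieldType) (U : unitAlgType K).
Implicit Types (c d : K) (u v x : U).

Definition skew c u x : Prop := x * u = c *: (u * x).

Lemma skew1 x : skew 1 1 x.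
Proof. by rewrite /skew mulr1 mul1r scale1r. Qed.

Lemma skewM c d u v x : skew c u x -> skew d v x -> skew (c * d) (u * v) x.
Proof.
rewrite /skew => hu hv.
by rewrite mulrA hu -scalerAl -(mulrA u x) hv -scalerAr scalerA mulrA.
Qed.

Lemma skewXn c u x n : skew c u x -> skew (c ^+ n) (u ^+ n) x.
Proof.
by move=> h; elim: n => [|n IHn]; [apply: skew1 | rewrite !exprS; apply: skewM].
Qed.

Lemma skewV c u x : c != 0 -> u \is a GRing.unit ->
  skew c u x -> skew c^-1 u^-1 x.
Proof.
move=> c0 uu; rewrite /skew => h.
have -> : u^-1 * x = u^-1 * (x * u) * u^-1 by rewrite mulrA mulrK.
by rewrite h -scalerAr mulKr// -scalerAl scalerA mulVf// scale1r.
Qed.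

Lemma skewXz c u x (a : int) : c != 0 -> u \is a GRing.unit ->
  skew c u x -> skew (c ^ a) (u ^ a) x.
Proof.
move=> c0 uu h; case: a => n; first exact: skewXn.
rewrite !NegzE -!exprnN -!exprVn; apply: skewXn; exact: skewV.
Qed.

Lemma skew_exp c u x n : skew c u x -> skew (c ^+ n) u (x ^+ n).
Proof.
rewrite /skew => h; elim: n => [|n IHn]; first by rewrite !expr0 mul1r mulr1 scale1r.
by rewrite !exprSr -(mulrA _ x u) h -scalerAr !mulrA IHn -scalerAl scalerA mulrC.
Qed.

End SkewCommutation.

(** * Multiplication of monomials *)

Section UTq2.
Variables (K : fieldType) (q : K) (U : unitAlgType K) (x11 x12 x22 : U).
Hypotheses (q0 : q != 0) (hU : is_UTq2 q x11 x12 x22).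

Let u11 : x11 \is a GRing.unit := UTq2_unit11 hU.
Let u22 : x22 \is a GRing.unit := UTq2_unit22 hU.

Definition torus (a b : int) : U := x11 ^ a * x22 ^ b.

Definition mon (i : idx) : U := torus i.1.1 i.1.2 * x12 ^+ i.2.

Lemma torusD a b c d : torus a b * torus c d = torus (a + c) (b + d).
Proof.
have comm : x22 ^ b * x11 ^ c = x11 ^ c * x22 ^ b.
  by have [_ _ h] := UTq2_rel hU; apply/commrXz/commr_sym/commrXz.
by rewrite /torus !exprzDr// !mulrA -(mulrA (x11 ^ a) (x22 ^ b)) comm !mulrA.
Qed.

Lemma torus10 : torus 1 0 = x11. Proof. by rewrite /torus expr0z mulr1. Qed.

Lemma torus01 : torus 0 1 = x22. Proof. by rewrite /torus expr0z mul1r. Qed.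

Lemma torus00 : torus 0 0 = 1. Proof. by rewrite /torus !expr0z mulr1. Qed.

Lemma torus_unit a b : torus a b \is a GRing.unit.
Proof. by rewrite unitrMl unitrXz. Qed.

Lemma skew_torus a b : skew (q ^ (- (a + b))) (torus a b) x12.
Proof.
have [h2 h1 _] := UTq2_rel hU.
have qV0 : q^-1 != 0 by rewrite invr_eq0.
have h u : u * x12 = q *: (x12 * u) -> skew q^-1 u x12.
  by rewrite /skew => ->; rewrite scalerA mulVf// scale1r.
rewrite -exprz_inv expfzDr//; apply: skewM; apply: skewXz => //; exact: h.
Qed.

(** The scalar produced by moving [x12 ^+ i.2] to the right past the torus part of [mon j]. *)
Definition twist (i j : idx) : K := (q ^ (- (j.1.1 + j.1.2))) ^+ i.2.

Lemma twist_neq0 i j : twist i j != 0.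
Proof. by rewrite expf_neq0// expfz_neq0. Qed.

Lemma monM i j : mon i * mon j = twist i j *: mon (addi i j).
Proof.
case: i j => [[a b] n] [[c d] m]; rewrite /mon /twist /addi /=.
rewrite mulrA -(mulrA (torus a b)) (skew_exp n (skew_torus c d)).
by rewrite -scalerAr -scalerAl (mulrA _ (torus c d)) torusD exprD mulrA.
Qed.

Lemma mon0 : mon (0, 0, 0%N) = 1.
Proof. by rewrite /mon torus00 mulr1. Qed.

Lemma mon1 a b : mon (a, b, 0%N) = torus a b.
Proof. by rewrite /mon mulr1. Qed.

Lemma x12E : x12 = mon (0, 0, 1%N).
Proof. by rewrite /mon torus00 mul1r. Qed.

(** * Representation on coefficient functions and linear independence *)

Program Definition shift (a b : int) : lin_end K :=
  @LinEnd K (fun v i => v (i.1.1 - a, i.1.2 - b, i.2)) _.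

(** Left multiplication by [x12] in coordinates: the power of [q] is the one from [skew_torus], and
    no monomial of degree 0 in [x12] is hit. *)
Program Definition raise12 : lin_end K :=
  @LinEnd K (fun v i =>
    if i.2 is n.+1 then q ^ (- (i.1.1 + i.1.2)) * v (i.1, n) else 0) _.
Next Obligation.
by case: (i.2) => [|n]; rewrite ?mulr0 ?addr0// mulrDr mulrCA.
Qed.

Lemma shiftD a b c d : shift a b * shift c d = shift (a + c) (b + d).
Proof.
apply: lin_endP => v [[i j] n] /=; congr (v (_, _, _)); lia.
Qed.

Lemma shift0 : shift 0 0 = 1.
Proof. by apply: lin_endP => v [[i j] n] /=; rewrite !subr0. Qed.

Local Notation E := (with_units (lin_end K)).

Lemma shift_unit a b : (shift a b : E) \is a GRing.unit.
Proof.
by apply/unitrP; exists (shift (- a) (- b)); split;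
  rewrite [LHS]shiftD ?addNr ?addrN shift0.
Qed.

Lemma shift_relations :
  Tq2_relations q (shift 1 0) raise12 (shift 0 1).
Proof.
split; apply: lin_endP => v [[i j] [|n]] /=; rewrite ?mulr0 ?subr0//.
- rewrite mulrA; congr (_ * _); rewrite -[in RHS](expr1z q) -expfzDr//.
  by congr (_ ^ _); lia.
- rewrite mulrA; congr (_ * _); rewrite -[in RHS](expr1z q) -expfzDr//.
  by congr (_ ^ _); lia.
Qed.

Lemma rep_subproof : {f : {lrmorphism U -> E} |
  [/\ f x11 = shift 1 0, f x12 = raise12 & f x22 = shift 0 1]}.
Proof.
apply: cid; apply: (UTq2_lift hU).
- exact: shift_relations.
- exact: shift_unit.
- exact: shift_unit.
Qed.

Definition rep : {lrmorphism U -> E} := sval rep_subproof.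

Definition delta0 (i : idx) : K := (i == (0, 0, 0%N))%:R.

(** [delta0] is the coordinate function of 1, so acting on it with [u] yields the coordinates of
    [u]. *)
Definition coef (i : idx) (u : U) : K := (rep u : lin_end K) delta0 i.

Fact coef_is_linear i : linear_for *%R (coef i).
Proof. by move=> a u v; rewrite /coef linearP. Qed.

HB.instance Definition _ i :=
  GRing.isLinear.Build K U K *%R (coef i) (coef_is_linear i).

Lemma rep_torus a b : rep (torus a b) = shift a b.
Proof.
have [e1 _ e3] := svalP rep_subproof; rewrite -/rep in e1 e3.
have natmulE (k : int) n : k *+ n = k * n by rewrite -mulr_natr natz.
have shX c d n : (shift c d : E) ^+ n = shift (c *+ n) (d *+ n).
  elim: n => [|n IHn]; first by rewrite !mulr0n shift0.
  by rewrite exprS IHn [LHS]shiftD !mulrS.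
have shV c d : (shift c d : E)^-1 = shift (- c) (- d).
  apply: (mulrI (shift_unit c d)); rewrite mulrV ?shift_unit//.
  by rewrite [RHS]shiftD !addrN shift0.
have shXz c d (k : int) : (shift c d : E) ^ k = shift (c * k) (d * k).
  case: k => n; first by rewrite [LHS]shX !natmulE.
  by rewrite NegzE -exprnN -exprVn shV shX !natmulE; congr shift; lia.
rewrite rmorphM !rmorphXz//= e1 e3 !shXz.
by rewrite [LHS]shiftD; congr shift; lia.
Qed.

Lemma rep12 : rep x12 = raise12.
Proof. by have [_ e2 _] := svalP rep_subproof. Qed.

Lemma coef_mon i j : coef j (mon i) = (i == j)%:R.
Proof.
case: i j => [[a b] n] [[c d] m]; rewrite /coef /mon rmorphM rmorphXn /=.
rewrite rep_torus rep12 /=.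
have -> : (raise12 : E) ^+ n = raise12 ^+ n :> lin_end K by [].
(* On functions supported at torus exponents [(0, 0)] the factor in [raise12] is [q ^ 0 = 1], so
   only the degree in [x12] moves. *)
have h k : (raise12 ^+ k) delta0 = fun i => (i == (0, 0, k))%:R.
  elim: k => [|k IHk]; first by apply/funext.
  rewrite exprS /= IHk; apply/funext => -[[e f] [|p]] /=.
    by rewrite !xpair_eqE andbF.
  rewrite !xpair_eqE eqSS; case: eqP => [->|]; last by rewrite mulr0.
  by case: eqP => [->|]; rewrite /= ?mulr0// addr0 oppr0 expr0z mul1r.
rewrite h; congr (_%:R); rewrite !xpair_eqE; lia.
Qed.

(** * The monomials span *)

Definition expandable (u : U) (s : seq idx) : Prop :=
  forall t, uniq t -> {subset s <= t} -> u = \sum_(i <- t) coef i u *: mon i.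

Lemma expandable_mon i : expandable (mon i) [:: i].
Proof.
move=> t ut /(_ i); rewrite inE eqxx => /(_ isT) it.
rewrite (bigD1_seq i)//= coef_mon eqxx scale1r big1 ?addr0// => j.
by rewrite coef_mon eq_sym => /negPf ->; rewrite scale0r.
Qed.

(** Since [expandable] allows every duplicate-free list containing the support, both expansions can
    be read over the same list and added termwise. *)
Lemma expandableP a u v s t : expandable u s -> expandable v t ->
  expandable (a *: u + v) (s ++ t).
Proof.
move=> hu hv r ur sr.
rewrite [in LHS](hu r)// => [|i ins]; last by apply: sr; rewrite mem_cat ins.
rewrite [in LHS](hv r)// => [|i ins]; last by apply: sr; rewrite mem_cat ins orbT.
rewrite scaler_sumr -big_split; apply: eq_bigr => i _ /=.
by rewrite linearP scalerDl scalerA.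
Qed.

Lemma expandable_sum (I : Type) (r : seq I) (F : I -> U) :
  (forall i, exists s, expandable (F i) s) ->
  exists s, expandable (\sum_(i <- r) F i) s.
Proof.
move=> h; elim: r => [|i r [s IHs]].
  exists [::] => t ut _; rewrite big_nil big1// => i _.
  by rewrite linear0 scale0r.
have [t ht] := h i; exists (t ++ s); rewrite big_cons -[F i]scale1r.
exact: expandableP.
Qed.

Lemma expandableZ a u : (exists s, expandable u s) ->
  exists s, expandable (a *: u) s.
Proof.
move=> [s us]; exists (s ++ [::]); rewrite -[_ *: _]addr0.
apply: expandableP => // t _ _; rewrite big1// => i _.
by rewrite linear0 scale0r.
Qed.

(** The expandable elements form a subalgebra, closed under products by [monM], and it contains the
    generators and the two inverses. *)
Lemma all_expandable u : exists s, expandable u s.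
Proof.
suff: u \in (fun u : U => `[< exists s, expandable u s >]) by move/asboolP.
apply: (UTq2_ind hU).
- split.
  + by apply/asboolP; exists [:: (0, 0, 0%N)]; rewrite -mon0; apply: expandable_mon.
  + move=> a v w /asboolP[s vs] /asboolP[t wt]; apply/asboolP.
    by exists (s ++ t); apply: expandableP.
  + move=> v w /asboolP[s vs] /asboolP[t wt]; apply/asboolP.
    rewrite (vs _ (undup_uniq s)) => [|i]; last by rewrite mem_undup.
    rewrite mulr_suml; apply: expandable_sum => i.
    rewrite (wt _ (undup_uniq t)) => [|j]; last by rewrite mem_undup.
    rewrite mulr_sumr; apply: expandable_sum => j.
    rewrite -scalerAl -scalerAr monM; do 3!apply: expandableZ.
    by exists [:: addi i j]; apply: expandable_mon.
- apply/asboolP; exists [:: (1, 0, 0%N)].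
  rewrite [x11](_ : _ = mon (1, 0, 0%N)); first exact: expandable_mon.
  by rewrite mon1 /torus expr0z mulr1.
- apply/asboolP; exists [:: (-1, 0, 0%N)].
  rewrite [x11^-1](_ : _ = mon (-1, 0, 0%N)); first exact: expandable_mon.
  by rewrite mon1 /torus expr0z mulr1.
- by apply/asboolP; exists [:: (0, 0, 1%N)]; rewrite {1}x12E; apply: expandable_mon.
- apply/asboolP; exists [:: (0, 1, 0%N)].
  rewrite [x22](_ : _ = mon (0, 1, 0%N)); first exact: expandable_mon.
  by rewrite mon1 /torus expr0z mul1r.
- apply/asboolP; exists [:: (0, -1, 0%N)].
  rewrite [x22^-1](_ : _ = mon (0, -1, 0%N)); first exact: expandable_mon.
  by rewrite mon1 /torus expr0z mul1r.
Qed.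

Lemma mon_expansion u : exists s, [/\ uniq s,
  forall i, (i \in s) = (coef i u != 0) & u = \sum_(i <- s) coef i u *: mon i].
Proof.
have [t ht] := all_expandable u.
(* Dropping zero coefficients makes the list the exact support; an index outside [t] has coefficient
   zero by [coef_mon]. *)
pose s := [seq i <- undup t | coef i u != 0].
have eu : u = \sum_(i <- s) coef i u *: mon i.
  rewrite big_filter [LHS](ht _ (undup_uniq t)) => [|i]; last by rewrite mem_undup.
  rewrite [LHS](bigID (fun i => coef i u != 0)) /= [X in _ + X]big1 ?addr0// => i.
  by rewrite negbK => /eqP ->; rewrite scale0r.
exists s; split=> //; first by rewrite filter_uniq ?undup_uniq.
move=> i; rewrite mem_filter andb_idr// mem_undup; apply: contraNT => it.
rewrite (ht _ (undup_uniq t)) => [|j]; last by rewrite mem_undup.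
rewrite linear_sum big1_seq// => j /andP[_]; rewrite mem_undup => jt.
rewrite linearZ /= coef_mon (_ : (j == i) = false) ?mulr0//.
by apply: contraNF it => /eqP <-.
Qed.

(** * Extremal terms of products and factors of monomials *)

Lemma coefM k u v s t : u = \sum_(i <- s) coef i u *: mon i ->
  v = \sum_(j <- t) coef j v *: mon j ->
  coef k (u * v) = \sum_(i <- s) \sum_(j <- t)
     coef i u * (coef j v * (twist i j * (addi i j == k)%:R)).
Proof.
move=> eu ev; rewrite {1}eu {1}ev mulr_suml linear_sum.
apply: eq_bigr => i _; rewrite mulr_sumr linear_sum; apply: eq_bigr => j _.
by rewrite -scalerAl -scalerAr monM !linearZ /= coef_mon.
Qed.

(** By cancellation the pair of maxima is the only pair of support indices with its sum, so nothing
    can cancel that term. The order is a parameter so that the converse of [lexi] covers the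
    smallest terms. *)
Lemma extremal_coef (le : rel idx) u v s t : total le -> transitive le ->
  (forall i j i0 j0, le i i0 -> le j j0 -> addi i j = addi i0 j0 ->
     i = i0 /\ j = j0) ->
  uniq s -> (forall i, (i \in s) = (coef i u != 0)) ->
  u = \sum_(i <- s) coef i u *: mon i ->
  uniq t -> (forall j, (j \in t) = (coef j v != 0)) ->
  v = \sum_(j <- t) coef j v *: mon j ->
  u != 0 -> v != 0 -> exists i j, [/\ i \in s /\ (forall i', i' \in s -> le i' i),
    j \in t /\ (forall j', j' \in t -> le j' j) & coef (addi i j) (u * v) != 0].
Proof.
move=> le_total le_trans le_cancel us su eu ut tv ev un0 vn0.
have [|i si imax] := seq_maximum (s := s) le_total le_trans.
  by apply: contraNneq un0 => s0; rewrite eu s0 big_nil.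
have [|j tj jmax] := seq_maximum (s := t) le_total le_trans.
  by apply: contraNneq vn0 => t0; rewrite ev t0 big_nil.
exists i, j; split => //.
rewrite (coefM _ eu ev) (bigD1_seq i)//= (bigD1_seq j)//= eqxx.
rewrite [X in _ + X + _]big1_seq => [|j' /andP[j'j tj']]; last first.
  case: eqP; rewrite ?mulr0// => /(le_cancel _ _ _ _ (imax _ si) (jmax _ tj')).
  by case=> _ e; rewrite e eqxx in j'j.
rewrite big1_seq => [|i' /andP[i'i si']]; last first.
  rewrite big1_seq// => j' /andP[_ tj']; case: eqP; rewrite ?mulr0//.
  move=> /(le_cancel _ _ _ _ (imax _ si') (jmax _ tj')).
  by case=> e _; rewrite e eqxx in i'i.
by rewrite !addr0 mulr1 !mulf_neq0 ?twist_neq0 -?su -?tv.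
Qed.

(* The lexicographically largest terms of [u] and [v] multiply to a nonzero
   term of [u * v], and so do the smallest ones. *)
Lemma mon_factor u v k : u * v = mon k -> exists (c d : K) i j,
  [/\ c != 0, d != 0, u = c *: mon i, v = d *: mon j & addi i j = k].
Proof.
move=> uv.
have uvn0 : u * v != 0.
  apply/eqP => /(congr1 (coef k)); rewrite uv coef_mon eqxx linear0 => /eqP.
  by rewrite oner_eq0.
have un0 : u != 0 by apply: contraNneq uvn0 => ->; rewrite mul0r.
have vn0 : v != 0 by apply: contraNneq uvn0 => ->; rewrite mulr0.
have [s [us su eu]] := mon_expansion u.
have [t [ut tv ev]] := mon_expansion v.
have top l : coef l (u * v) != 0 -> l = k.
  by rewrite uv coef_mon; case: (k =P l) => [->//|_]; rewrite eqxx.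
have [i [j [[si imax] [tj jmax] /top ijk]]] := extremal_coef lexi_total lexi_trans
  lexi_addi_cancel us su eu ut tv ev un0 vn0.
have ge_total : total (fun a b => lexi b a) by move=> a b; apply: lexi_total.
have ge_trans : transitive (fun a b => lexi b a).
  by move=> b a c ab bc; apply: lexi_trans bc ab.
have ge_cancel a b a0 b0 : lexi a0 a -> lexi b0 b -> addi a b = addi a0 b0 ->
    a = a0 /\ b = b0.
  by move=> la lb e; have [-> ->] := lexi_addi_cancel la lb (esym e).
have [i' [j' [[si' imin] [tj' jmin] /top ijk']]] := extremal_coef ge_total
  ge_trans ge_cancel us su eu ut tv ev un0 vn0.
(* The largest and the smallest pairs both add up to [k], so they coincide and each support is a
   singleton. *)
have [ei ej] := lexi_addi_cancel (imax _ si') (jmax _ tj')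
  (etrans ijk' (esym ijk)).
exists (coef i u), (coef j v), i, j; split; rewrite -?su -?tv//.
- rewrite {1}eu (bigD1_seq i)//= big1_seq ?addr0// => a /andP[ai sa].
  have e : a = i by apply: lexi_anti; rewrite imax//= -{1}ei imin.
  by rewrite e eqxx in ai.
- rewrite {1}ev (bigD1_seq j)//= big1_seq ?addr0// => a /andP[aj sa].
  have e : a = j by apply: lexi_anti; rewrite jmax//= -{1}ej jmin.
  by rewrite e eqxx in aj.
Qed.
(** * The group G *)

Local Notation calG := (in_calG x11 x12 x22).
Implicit Types (f phi psi : {lrmorphism U -> U}).

Lemma mon_scale_inj (c d : K) i j : c != 0 -> c *: mon i = d *: mon j -> i = j.
Proof.
move=> c0 /(congr1 (coef i)) /eqP; rewrite !linearZ /= !coef_mon eqxx mulr1.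
by case: (j =P i) => [->//|_]; rewrite mulr0 (negPf c0).
Qed.

Lemma scale_torusXz (c : K) (a b m : int) : c != 0 ->
  (c *: torus a b) ^ m = c ^ m *: torus (a * m) (b * m).
Proof.
move=> c0; have u := torus_unit a b.
have tX n : torus a b ^+ n = torus (a * n) (b * n).
  elim: n => [|n IHn]; first by rewrite !mulr0 torus00.
  by rewrite exprS IHn torusD; congr torus; lia.
have tV : (c *: torus a b)^-1 = c^-1 *: torus (- a) (- b).
  rewrite invrZ ?unitfE//; congr (_ *: _); apply: (mulrI u).
  by rewrite mulrV// torusD !addrN torus00.
case: m => n; first by rewrite [LHS]exprZn tX.
have tXN n' : torus (- a) (- b) ^+ n' = torus (- a * n') (- b * n').
  elim: n' => [|p IHp]; first by rewrite !mulr0 torus00.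
  by rewrite exprS IHp torusD; congr torus; lia.
rewrite NegzE -!exprnN -!exprVn tV exprZn tXN; congr (_ *: torus _ _); lia.
Qed.

(** A morphism acts on torus exponents by an integer matrix. The scalar stays existential: later
    arguments need only that it is nonzero. *)
Lemma morph_torus f (l11 l22 : K) (a b c d : int) : l11 != 0 -> l22 != 0 ->
  f x11 = l11 *: torus a b -> f x22 = l22 *: torus c d ->
  forall m n, exists2 s, s != 0 &
    f (torus m n) = s *: torus (a * m + c * n) (b * m + d * n).
Proof.
move=> l11n0 l22n0 f11 f22 m n; exists (l11 ^ m * l22 ^ n).
  by rewrite mulf_neq0 ?expfz_neq0.
rewrite {1}/torus rmorphM !rmorphXz//= f11 f22 !scale_torusXz//.
by rewrite -scalerAl -scalerAr scalerA torusD.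
Qed.

Lemma torus_mon a b i : torus a b * mon i = mon (a + i.1.1, b + i.1.2, i.2).
Proof. by rewrite /mon mulrA torusD. Qed.

Lemma morph_mon1 f (l11 l12 l22 : K) (a b c d k l : int) :
  l11 != 0 -> l12 != 0 -> l22 != 0 ->
  f x11 = l11 *: torus a b -> f x22 = l22 *: torus c d ->
  f x12 = l12 *: mon (k, l, 1%N) ->
  forall m n, exists2 s, s != 0 & f (mon (m, n, 1%N)) =
    s *: mon (a * m + c * n + k, b * m + d * n + l, 1%N).
Proof.
move=> l11n0 l12n0 l22n0 f11 f22 f12 m n.
have [s s0 fs] := morph_torus l11n0 l22n0 f11 f22 m n.
exists (s * l12); first exact: mulf_neq0.
rewrite {1}/mon /= expr1 rmorphM /= fs f12.
by rewrite -scalerAl -scalerAr scalerA torus_mon.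
Qed.

(** Against an element of degree 1 in [x12], a torus monomial of total degree 1 commutes with factor
    exactly [q], so the relations survive. *)
Lemma endo_exists (l11 l12 l22 : K) (a b c d k l : int) :
  l11 != 0 -> l12 != 0 -> l22 != 0 -> a + b = 1 -> c + d = 1 ->
  exists f, [/\ f x11 = l11 *: torus a b, f x12 = l12 *: mon (k, l, 1%N) &
                f x22 = l22 *: torus c d].
Proof.
move=> l11n0 l12n0 l22n0 ab cd; apply: (UTq2_lift hU).
- have skew12 m n : m + n = 1 ->
      torus m n * mon (k, l, 1%N) = q *: (mon (k, l, 1%N) * torus m n).
    move=> mn; rewrite -!mon1 !monM /twist /addi /=.
    rewrite expr0 scale1r expr1 mn scalerA exprN1 mulfV// scale1r.
    by congr mon; rewrite addn0 (addrC m) (addrC n).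
  split; rewrite -!scalerAl -!scalerAr.
  + by rewrite skew12// !scalerA; congr (_ *: _); ring.
  + by rewrite skew12// !scalerA; congr (_ *: _); ring.
  + by rewrite !scalerA !torusD mulrC (addrC a) (addrC b).
- by rewrite scaler_unit ?unitfE// torus_unit.
- by rewrite scaler_unit ?unitfE// torus_unit.
Qed.


(** As [z ^ j] has exponents [(j, -j)], membership becomes a condition on exponent vectors. *)
Lemma calGP phi : calG phi <-> exists (l11 l12 l22 : K) (j k l : int),
  [/\ [/\ l11 != 0, l12 != 0 & l22 != 0],
      phi x12 = l12 *: mon (k, l, 1%N),
      phi x11 = l11 *: torus (1 + j) (- j) &
      phi x22 = l22 *: torus j (1 - j)].
Proof.
have zE : x11 / x22 = 1 *: torus 1 (-1) by rewrite scale1r.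
have z11 (j : int) : (x11 / x22) ^ j * x11 = torus (1 + j) (- j).
  rewrite zE scale_torusXz ?oner_neq0// exp1rz scale1r.
  by rewrite -torus10 torusD; congr torus; lia.
have z22 (j : int) : (x11 / x22) ^ j * x22 = torus j (1 - j).
  rewrite zE scale_torusXz ?oner_neq0// exp1rz scale1r.
  by rewrite -torus01 torusD; congr torus; lia.
rewrite /in_calG; split=> -[l11 [l12 [l22 [j [k [l [h1 h2 h3 h4]]]]]]];
  exists l11, l12, l22, j, k, l; split; rewrite ?h2 ?h3 ?h4 ?z11 ?z22//.
Qed.

(** Members of G fix [z] up to a scalar, so the parameters [j] add. *)
Lemma calG_comp phi psi : calG phi -> calG psi -> calG (phi \o psi).
Proof.
move=> /calGP[l11 [l12 [l22 [j [k [l [[l11n0 l12n0 l22n0] f12 f11 f22]]]]]]].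
move=> /calGP[m11 [m12 [m22 [j' [k' [l' [[m11n0 m12n0 m22n0] g12 g11 g22]]]]]]].
have [s11 s11n0 e11] := morph_torus l11n0 l22n0 f11 f22 (1 + j') (- j').
have [s22 s22n0 e22] := morph_torus l11n0 l22n0 f11 f22 j' (1 - j').
have [s12 s12n0 e12] := morph_mon1 l11n0 l12n0 l22n0 f11 f22 f12 k' l'.
apply/calGP; exists (m11 * s11), (m12 * s12), (m22 * s22), (j + j').
eexists; eexists; split.
- by rewrite !mulf_neq0.
- by rewrite /= g12 linearZ /= e12 scalerA.
- by rewrite /= g11 linearZ /= e11 scalerA; congr (_ *: torus _ _); ring.
- by rewrite /= g22 linearZ /= e22 scalerA; congr (_ *: torus _ _); ring.
Qed.

Lemma calG_id : calG idfun.
Proof.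
apply/calGP; exists 1, 1, 1, 0, 0, 0; rewrite !oner_neq0 !scale1r.
split=> //=; first exact: x12E.
  by rewrite /torus oppr0 addr0 expr0z mulr1.
by rewrite /torus subr0 expr0z mul1r.
Qed.

Lemma calG_right_inverse phi : calG phi ->
  exists2 psi, calG psi & cancel psi phi.
Proof.
move=> /calGP[l11 [l12 [l22 [j [k [l [[l11n0 l12n0 l22n0] f12 f11 f22]]]]]]].
(* The exponent matrix of [phi] is I + jN with N squared zero, so its inverse is I - jN. The
   exponents used for [x12] are the image of [(-k, -l)] under I - jN, and the scalars of the inverse
   cancel [s11], [s12], [s22]. *)
have [s11 s11n0 e11] := morph_torus l11n0 l22n0 f11 f22 (1 - j) j.
have [s22 s22n0 e22] := morph_torus l11n0 l22n0 f11 f22 (- j) (1 + j).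
have [s12 s12n0 e12] := morph_mon1 l11n0 l12n0 l22n0 f11 f22 f12
  (- k + j * k + j * l) (- j * k - (1 + j) * l).
have [||||| psi [g11 g12 g22]] := @endo_exists s11^-1 s12^-1 s22^-1
  (1 - j) j (- j) (1 + j) (- k + j * k + j * l) (- j * k - (1 + j) * l);
  rewrite ?invr_neq0//; try lia.
exists psi.
  apply/calGP; exists s11^-1, s12^-1, s22^-1, (- j),
    (- k + j * k + j * l), (- j * k - (1 + j) * l).
  by rewrite opprK; split=> //; split; rewrite invr_neq0.
apply: (UTq2_unique hU (f := phi \o psi) (g := idfun)) => /=.
- rewrite g11 linearZ /= e11 scalerA mulVf// scale1r.
  rewrite (_ : _ + _ = 1); last by ring.
  by rewrite (_ : _ + _ = 0) /torus ?expr0z ?mulr1//; ring.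
- rewrite g12 linearZ /= e12 scalerA mulVf// scale1r.
  rewrite [RHS]x12E; congr mon; congr (_, _, _); ring.
- rewrite g22 linearZ /= e22 scalerA mulVf// scale1r.
  rewrite (_ : _ + _ = 0); last by ring.
  by rewrite (_ : _ + _ = 1) /torus ?expr0z ?mul1r//; ring.
Qed.

Lemma calG_inverse phi : calG phi ->
  exists psi, [/\ calG psi, cancel psi phi & cancel phi psi].
Proof.
move=> Gphi; have [psi Gpsi psiK] := calG_right_inverse Gphi.
(* The right inverse [psi] has a right inverse itself, so it is surjective and hence two-sided. *)
have [chi _ chiK] := calG_right_inverse Gpsi; exists psi; split=> // x.
by rewrite -{1}[x]chiK psiK.
Qed.

Lemma calG_bijective phi : calG phi -> bijective phi.
Proof. by move=> /calG_inverse[psi [_ psiK phiK]]; exists psi. Qed.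

Lemma calG_subgroup : is_subgroup [set phi : alg_aut U | calG phi].
Proof.
split=> [|x y]; rewrite ?inE /=.
  exact: calG_id.
move=> Gx Gy; have [psi [Gpsi psiK yK]] := calG_inverse Gy.
have yV v : (y^-1)%g v = psi v by rewrite -{1}[v]psiK; apply: (aut_inv_funK y).
(* Membership depends only on the values at the generators, so it transfers from [x \o psi] to
   [x * y^-1]. *)
move/calGP: (calG_comp Gx Gpsi) => /=.
by rewrite -!yV => h; apply/calGP.
Qed.

(** * Automorphisms when q is not a root of unity *)

(** A unit is a factor of the monomial 1, and natural degrees in [x12] adding up to 0 both
    vanish. *)
Lemma unit_torus u : u \is a GRing.unit ->
  exists (c : K) a b, c != 0 /\ u = c *: torus a b.
Proof.
move=> uu; have /mon_factor : u * u^-1 = mon (0, 0, 0%N).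
  by rewrite mon0 mulrV.
move=> [c [_ [[[a b] n] [[[a' b'] n'] [c0 _ -> _ [_ _ n0]]]]]]; exists c, a, b.
have -> : n = 0%N by lia.
by rewrite mon1.
Qed.

Lemma x12_neq0 : x12 != 0.
Proof.
apply/eqP => /(congr1 (coef (0, 0, 1%N))).
have -> := congr1 (coef (0, 0, 1%N)) x12E.
by rewrite coef_mon linear0 eqxx => /eqP; rewrite oner_eq0.
Qed.

Lemma coef_torusM a b i u : coef (addi (a, b, 0%N) i) (torus a b * u) = coef i u.
Proof.
have [s [_ _ eu]] := mon_expansion u; rewrite {1 2}eu mulr_sumr !linear_sum.
apply: eq_bigr => j _; rewrite -scalerAr -mon1 monM !linearZ /=.
rewrite !coef_mon /twist expr0 mul1r; congr (_ * _%:R).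
by case: i j => [[c d] n] [[e f] m]; rewrite /addi !xpair_eqE /=; lia.
Qed.

(** Unlike left multiplication in [coef_torusM], multiplication on the right also scales by a power
    of [q] depending on the degree in [x12]; comparing the two drives [torus_commutation]. *)
Lemma coef_Mtorus a b i u : coef (addi (a, b, 0%N) i) (u * torus a b) =
  (q ^ (- (a + b))) ^+ i.2 * coef i u.
Proof.
have [s [_ _ eu]] := mon_expansion u.
rewrite {1 2}eu mulr_suml !linear_sum mulr_sumr.
apply: eq_bigr => j _; rewrite -scalerAl -mon1 monM !linearZ /=.
rewrite !coef_mon /twist /= [RHS]mulrCA; congr (_ * _).
case: (j =P i) => [->|ji].
  have -> : addi i (a, b, 0%N) = addi (a, b, 0%N) i.
    by rewrite /addi /= addn0 (addrC a) (addrC b).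
  by rewrite !eqxx.
rewrite [_ == _](_ : _ = false) ?mulr0//; apply/eqP => e; apply: ji.
case: i j e => [[c d] n] [[e f] m]; rewrite /addi /= => -[? ? ?].
by congr (_, _, _); lia.
Qed.

Hypothesis q_not_root : forall n : nat, (0 < n)%N -> q ^+ n != 1.

Lemma q_expz_eq1 (m : int) : q ^ m = 1 -> m = 0.
Proof.
case: m => [[//|n] h|n h].
  by case/eqP: (q_not_root (ltn0Sn n)).
have := q_not_root (ltn0Sn n); rewrite NegzE -exprnN in h.
by rewrite -[q ^+ _]invrK h invr1 eqxx.
Qed.

Lemma torus_commutation a b u i : torus a b * u = q *: (u * torus a b) ->
  coef i u != 0 -> a + b = 1 /\ i.2 = 1%N.
Proof.
move=> h ui; have := congr1 (coef (addi (a, b, 0%N) i)) h.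
rewrite coef_torusM linearZ /= coef_Mtorus mulrA -{1}[coef i u]mul1r.
move=> /(mulIf ui) /esym e.
have /q_expz_eq1 e' : q ^ (1 - (a + b) * i.2) = 1.
  by rewrite expfzDr// -mulNr -exprz_exp.
(* Since [q] has infinite order, [(a + b) * i.2 = 1] over the integers, which forces [i.2 = 1] and
   then [a + b = 1]. *)
have : (`|(a + b)%R| * i.2)%N = 1%N.
  by rewrite -[i.2]/`|i.2%:Z|%N -abszM -(subr0_eq e').
move/eqP; rewrite muln_eq1 => /andP[_ /eqP i1]; split=> //.
by move/subr0_eq: e'; rewrite i1 mulr1.
Qed.

Lemma automorphism_shape phi : bijective phi -> exists (l11 l22 : K) (a c : int),
  [/\ [/\ l11 != 0, l22 != 0,
          phi x11 = l11 *: torus a (1 - a) & phi x22 = l22 *: torus c (1 - c)],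
      forall i, coef i (phi x12) != 0 -> i.2 = 1%N &
      exists g, phi x12 = g * x12].
Proof.
move=> phi_bij.
have [l11 [a [b [l11n0 f11]]]] := unit_torus (rmorph_unit phi u11).
have [l22 [c [d [l22n0 f22]]]] := unit_torus (rmorph_unit phi u22).
have [R1 R2 _] := Tq2_relations_morph phi (UTq2_rel hU).
have C1 : torus a b * phi x12 = q *: (phi x12 * torus a b).
  apply: (scalerI l11n0); rewrite scalerAl -f11 R2 f11.
  by rewrite -scalerAr !scalerA mulrC.
have C2 : torus c d * phi x12 = q *: (phi x12 * torus c d).
  apply: (scalerI l22n0); rewrite scalerAl -f22 R1 f22.
  by rewrite -scalerAr !scalerA mulrC.
have [s [_ smem e12]] := mon_expansion (phi x12).
(* Injectivity gives [phi x12 != 0], so some term exists to which [torus_commutation] applies. *)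
have [i si] : exists i, i \in s.
  case: s smem e12 => [|i s _ _]; last by exists i; rewrite inE eqxx.
  rewrite big_nil => _ /eqP; rewrite (raddf_eq0 _ (bij_inj phi_bij)).
  by rewrite (negPf x12_neq0).
have [ab _] : a + b = 1 /\ i.2 = 1%N.
  by apply: torus_commutation C1 _; rewrite -smem.
have [cd _] : c + d = 1 /\ i.2 = 1%N.
  by apply: torus_commutation C2 _; rewrite -smem.
exists l11, l22, a, c; split.
- by rewrite -[in 1 - a]ab -cd ![_ + _ - _]addrAC !subrr !add0r.
- by move=> j /(torus_commutation C1)[].
exists (\sum_(j <- s) coef j (phi x12) *: torus j.1.1 j.1.2).
rewrite {1}e12 mulr_suml; apply: eq_big_seq => j sj.
have [_ j2] : a + b = 1 /\ j.2 = 1%N.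
  by apply: torus_commutation C1 _; rewrite -smem.
by rewrite -scalerAl /mon j2 expr1.
Qed.

Lemma automorphism_form phi : bijective phi ->
  exists (l11 l12 l22 : K) (a c k l : int),
  [/\ [/\ l11 != 0, l12 != 0 & l22 != 0],
      phi x11 = l11 *: torus a (1 - a), phi x22 = l22 *: torus c (1 - c),
      phi x12 = l12 *: mon (k, l, 1%N) & a - c = 1 \/ a - c = -1].
Proof.
move=> [psi' phiK psiK].
(* The inverse is taken in the automorphism group so that it is again an algebra morphism. *)
pose psi_aut := aut_inv (AlgAut (Bijective phiK psiK)).
pose psi : {lrmorphism U -> U} := psi_aut.
have phiK' : cancel phi psi by exact: aut_inv_funK.
have psiK' : cancel psi phi by exact: aut_inv_funVK.
have [l11 [l22 [a [c [[l11n0 l22n0 f11 f22] f12 _]]]]] :=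
  automorphism_shape (Bijective phiK psiK).
have [m11 [m22 [a' [c' [[m11n0 m22n0 g11 g22] _ [g g12]]]]]] :=
  automorphism_shape (Bijective psiK' phiK').
(* Applying [phi] to [psi x12 = g * x12] shows that [phi x12] divides the monomial [x12]. *)
have : phi g * phi x12 = mon (0, 0, 1%N) by rewrite -x12E -rmorphM /= -g12 psiK'.
move=> /mon_factor[_ [d [_ [[[k l] n] [_ d0 _ phi12 _]]]]].
have /= n1 : (k, l, n).2 = 1%N.
  by apply: f12; rewrite phi12 linearZ /= coef_mon eqxx mulr1.
rewrite n1 in phi12.
exists l11, d, l22, a, c, k, l; split=> //.
have [s s0 es] := morph_torus l11n0 l22n0 f11 f22 1 (-1).
have [t t0 et] := morph_torus m11n0 m22n0 g11 g22 (a - c) (c - a).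
(* Up to scalars [phi] sends [z] to [z ^ (a - c)] and [psi] sends it to [z ^ (a' - c')]; their
   composite is the identity, so the two exponents have product 1. *)
have : (s * t) *: mon ((a' - c') * (a - c), - ((a' - c') * (a - c)), 0%N) =
    1 *: mon (1, -1, 0%N).
  rewrite !mon1 scale1r -[RHS]phiK' es linearZ /=.
  rewrite [in RHS](_ : torus _ _ = torus (a - c) (c - a)); last first.
    by congr torus; ring.
  by rewrite et scalerA; congr (_ *: torus _ _); ring.
move/mon_scale_inj; rewrite mulf_neq0// => /(_ isT) [e _].
move: e; set x := a' - c'; set y := a - c => e.
have : (y == 1) || (y == -1).
  have : (`|x| * `|y|)%N = 1%N by rewrite -abszM e.
  by move/eqP; rewrite muln_eq1 => /andP[_ /eqP]; lia.
by case/orP => /eqP ->; [left|right].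
Qed.

(** * The swap and the semidirect product *)

Lemma swap_exists : exists rho : alg_aut U,
  [/\ rho x11 = x22, rho x12 = x12, rho x22 = x11 & (rho * rho = 1)%g].
Proof.
have n1 : 1 != 0 :> K := oner_neq0 K.
have [f [f11 f12 f22]] := endo_exists 0 0 n1 n1 n1 (add0r 1) (addr0 1).
rewrite !scale1r -?x12E in f11 f12 f22.
rewrite torus01 in f11; rewrite torus10 in f22.
have fK : cancel f f.
  apply: (UTq2_unique hU (f := f \o f) (g := idfun)) => /=.
  - by rewrite f11 f22.
  - by rewrite !f12.
  - by rewrite f22 f11.
exists (AlgAut (Bijective fK fK)); split=> //; apply: alg_autP; exact: fK.
Qed.

Section Swap.
Variable rho : alg_aut U.
Hypotheses (rho11 : rho x11 = x22) (rho12 : rho x12 = x12).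
Hypotheses (rho22 : rho x22 = x11) (rho2 : (rho * rho = 1)%g).

Lemma swap_torus a b : rho (torus a b) = torus b a.
Proof.
rewrite /torus rmorphM !rmorphXz//= rho11 rho22.
have [_ _ h] := UTq2_rel hU.
by apply/commrXz/commr_sym/commrXz.
Qed.

Lemma swap_mon1 k l : rho (mon (k, l, 1%N)) = mon (l, k, 1%N).
Proof. by rewrite /mon /= !expr1 rmorphM /= swap_torus rho12. Qed.

Lemma swapV : (rho^-1 = rho)%g.
Proof. by rewrite -[RHS]mul1g -(mulVg rho) -mulgA rho2 mulg1. Qed.

(** [rho] is an involution, so its powers alternate between 1 and [rho]. *)
Lemma cyclic_swap x : cyclic_sub rho x <-> x = 1%g \/ x = rho.
Proof.
have rhoX n : (rho ^+ n)%g = 1%g \/ (rho ^+ n)%g = rho.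
  elim: n => [|n [IHn|IHn]]; first by left.
    by right; rewrite expgS IHn mulg1.
  by left; rewrite expgS IHn.
split=> [[n [->|->]]|[->|->]].
- exact: rhoX.
- by case: (rhoX n) => ->; [left; rewrite invg1 | right; apply: swapV].
- by exists 0%N; left.
- by exists 1%N; left; rewrite expg1.
Qed.

(** This is conjugation, as [rho] is its own inverse: it exchanges the two torus exponents, sending
    [j] to [-j]. *)
Lemma calG_swap (x : alg_aut U) : calG x -> calG (rho * x * rho)%g.
Proof.
move=> /calGP[l11 [l12 [l22 [j [k [l [n0 f12 f11 f22]]]]]]].
apply/calGP; exists l22, l12, l11, (- j), l, k.
case: n0 => n1 n2 n3; split=> //=.
- by rewrite rho12 f12 linearZ /= swap_mon1.
- by rewrite rho11 f22 linearZ /= swap_torus opprK.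
- by rewrite rho22 f11 linearZ /= swap_torus opprK.
Qed.

(** The images of [x11] and [x22] would require [1 + j = 0] and [j = 1] at once. *)
Lemma calG_not_swap : ~ calG rho.
Proof.
move=> /calGP[l11 [l12 [l22 [j [k [l [[n1 n2 n3] _ f11 f22]]]]]]].
have /(mon_scale_inj n1) [e1 _] :
    l11 *: mon (1 + j, - j, 0%N) = 1 *: mon (0, 1, 0%N).
  by rewrite !mon1 -f11 rho11 scale1r torus01.
have /(mon_scale_inj n3) [e2 _] :
    l22 *: mon (j, 1 - j, 0%N) = 1 *: mon (1, 0, 0%N).
  by rewrite !mon1 -f22 rho22 scale1r torus10.
by rewrite e2 in e1.
Qed.

(** Precomposing with [rho] exchanges the images of [x11] and [x22], which turns the exponent
    difference -1 into 1. *)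
Lemma automorphism_factor (x : alg_aut U) : calG x \/ calG (x * rho)%g.
Proof.
have [l11 [l12 [l22 [a [c [k [l [n0 f11 f22 f12 ac]]]]]]]] :=
  automorphism_form (aut_bij x).
have [n1 n2 n3] := n0.
case: ac => ac; [left|right]; apply/calGP.
  exists l11, l12, l22, c, k, l; split=> //.
  by rewrite f11; congr (_ *: torus _ _); lia.
exists l22, l12, l11, a, k, l; split=> //=.
- by rewrite rho12.
- by rewrite rho11 f22; congr (_ *: torus _ _); lia.
- by rewrite rho22.
Qed.

Lemma calG_sdprod :
  is_internal_sdprod [set phi : alg_aut U | calG phi] (cyclic_sub rho).
Proof.
have Gsub := calG_subgroup.
have [G1 GD] := Gsub.
have GM (x y : alg_aut U) : calG x -> calG y -> calG (x * y)%g.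
  by move=> Gx Gy; exact: (calG_comp Gx Gy).
have GV (x : alg_aut U) : calG x -> calG (x^-1)%g.
  by move=> Gx; have := group_closedV Gsub (x := x); rewrite !inE; apply.
have factor (x : alg_aut U) : exists2 n : alg_aut U, calG n &
    exists2 h, cyclic_sub rho h & x = (n * h)%g.
  case: (automorphism_factor x) => [Gx|Gx].
    by exists x => //; exists 1%g; [apply/cyclic_swap; left | rewrite mulg1].
  exists (x * rho)%g => //; exists rho; first by apply/cyclic_swap; right.
  by rewrite -mulgA rho2 mulg1.
split; last exact: factor.
(* Normality: with [y = n * h], conjugation by [n] stays in the subgroup, and conjugation by [h] is
   trivial or [calG_swap]. *)
- split=> // x y Gx; have [n Gn [h /cyclic_swap[->|->] ->]] := factor y.
    by rewrite mulg1 /conjg; apply: (GM); [apply: (GV) | apply: (GM)].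
  rewrite conjgM /conjg swapV mulgA; apply: calG_swap.
  by apply: (GM); [apply: (GV) | apply: (GM)].
- split=> [|x y]; rewrite !inE; first by apply/cyclic_swap; left.
  move=> /cyclic_swap[->|->] /cyclic_swap[->|->]; apply/cyclic_swap.
  + by left; rewrite invg1 mulg1.
  + by right; rewrite swapV mul1g.
  + by right; rewrite invg1 mulg1.
  + by left; rewrite swapV rho2.
- apply/seteqP; split=> x /=.
    by move=> [Gx /cyclic_swap[//|xrho]]; case: calG_not_swap; rewrite -xrho.
  by move=> ->; split; [move: G1; rewrite inE | apply/cyclic_swap; left].
Qed.

End Swap.
End UTq2.

Theorem theorem6p5 (K : fieldType) (charK : 2%N \notin [pchar K])
    (q : K) (q0 : q != 0)
    (T : algType K) (a11 a12 a22 : T) (hT : is_Tq2 q a11 a12 a22)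
    (U : unitAlgType K) (iota : {lrmorphism T -> U})
    (hU : is_localization (mult_gen [set a11; a22]) iota) :
  let calG := in_calG (iota a11) (iota a12) (iota a22) in
  let autG := [set phi : alg_aut U | calG phi] in
  [/\ forall phi : {lrmorphism U -> U}, calG phi -> bijective phi,
      is_subgroup autG &
      (forall n : nat, (0 < n)%N -> q ^+ n != 1) ->
      exists rho : alg_aut U,
        [/\ rho (iota a12) = iota a12,
            rho (iota a11) = iota a22,
            rho (iota a22) = iota a11 &
            is_internal_sdprod autG (cyclic_sub rho)]].
Proof.
have UT := localization_UTq2 hT hU.
move=> calG autG; split=> [phi||q_not_root].
(* G is defined inside the endomorphisms; bijectivity places it inside the automorphism group. *)
- exact: (calG_bijective q0 UT).
- exact: (calG_subgroup q0 UT).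
- have [rho [rho11 rho12 rho22 rho2]] := swap_exists q0 UT.
  by exists rho; split=> //; apply: (calG_sdprod q0 UT).
Qed.
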